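(* Let $\varphi:[0,1)\to\mathbb{R}^+$ be non-decreasing and satisfy the following Muckenhoupt type inequality $$\left(\frac 1 t \int_0^t\varphi(y)\,dy\right)\left(\frac 1 t \int_0^t\varphi^{-1/(q-1)}(y)\,dy\right)^{q-1}\leq M\qquad\text{for every } t\in(0,1],$$ where $q>1$ is fixed and $M\geq 1$ is given. Let $p_0\in(1,q)$ be defined as the solution of the equation $$\frac{q-p_0}{q-1}\,(M\,p_0)^{1/(q-1)} = 1 .$$ Then for every $p\in(p_0,q]$ the inequality $$\frac 1 t \int_0^t\left(\frac 1 s \int_0^s \varphi(y)\,dy\right)^{-1/(p-1)}ds \;\leq\; \left(\frac 1 t \int_0^t\varphi(y)\,dy\right)^{-1/(p-1)}\frac{1}{K'}\,c\,\frac q p\left(\frac{p-1}{q-1}\right)^2$$ is true for every $t\in(0,1]$, where $c=M^{1/(q-1)}$ and $K'=K'(p,q,c)=\dfrac{1}{p^{1/(q-1)}}-c\,\dfrac{q-p}{q-1}$. It is also sharp for $t=1$.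
   Context: $\mathbb{R}^+$ denotes the positive real numbers. $\varphi^{-1/(q-1)}(y)$ denotes $(\varphi(y))^{-1/(q-1)}$.
   Formalization: ''Sharp for t=1'' is false as best constant for fixed p, q, M (for p=q=2 the constant 2M can be lowered to 2M-1/2); it is stated instead as: no factor below 1 can multiply the right side for p close to p_0 (q, M fixed), nor uniformly in M (p, q fixed). *)

(* Defs.v *)
From HB Require Import structures.
From mathcomp Require Import all_boot all_order all_algebra.
From mathcomp Require Import all_classical all_reals all_analysis.

Set Implicit Arguments.
Unset Strict Implicit.
Unset Printing Implicit Defensive.

Import Order.TTheory GRing.Theory Num.Theory.
Import numFieldNormedType.Exports.

Local Open Scope classical_set_scope.
Local Open Scope ring_scope.

(* Lebesgue mean (1/t) \int_0^t f. The interval is half-open so that, for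
   t <= 1, only the values of f on [0,1) matter; the mean may be +oo at t = 1. *)
Definition mean (R : realType) (f : R -> R) (t : R) : \bar R :=
  ((t^-1)%:E * \int[lebesgue_measure]_(y in `[0%R, t[) (f y)%:E)%E.

(* A function [0,1) -> R^+ is represented by a map on R whose values outside
   [0,1) are irrelevant. The product of means is computed in \bar R: both
   factors are positive, so the bound by M forces phi to be integrable on
   [0,1). *)
Definition muckenhoupt_weight (R : realType) (q M : R) (phi : R -> R) : Prop :=
  [/\ {in `[0, 1[, forall x, 0 < phi x},
      {in `[0, 1[ &, {homo phi : x y / x <= y}}
    & forall t, 0 < t <= 1 ->
      (mean phi t * mean (fun y => phi y `^ (- (q - 1)^-1))%R t `^ (q - 1)
       <= M%:E)%E].

Definition critical_exponent (R : realType) (q M p0 : R) : Prop :=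
  1 < p0 < q /\ (q - p0) / (q - 1) * (M * p0) `^ (q - 1)^-1 = 1.

(* For phi as above and 0 < t <= 1, mean phi t is finite and positive, so fine
   loses nothing; the outer mean stays in \bar R, so that an upper bound on it
   includes its finiteness. *)
Definition hardy_lhs (R : realType) (p : R) (phi : R -> R) (t : R) : \bar R :=
  mean (fun s => fine (mean phi s) `^ (- (p - 1)^-1)) t.

Definition hardy_K (R : realType) (p q c : R) : R :=
  (p `^ (q - 1)^-1)^-1 - c * ((q - p) / (q - 1)).

Definition hardy_rhs (R : realType) (p q M : R) (phi : R -> R) (t : R) : R :=
  let c := M `^ (q - 1)^-1 in
  fine (mean phi t) `^ (- (p - 1)^-1) *
  ((hardy_K p q c)^-1 * c * (q / p) * ((p - 1) / (q - 1)) ^+ 2).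

(* Sharpness of hardy_lhs <= hardy_rhs at t = 1: the right-hand side cannot be
   multiplied by a factor theta < 1. For a fixed triple (p, q, M) with p above
   the critical exponent the ratio hardy_lhs / hardy_rhs stays bounded away
   from 1, since the sharper constant
     K^-1 * ((p - 1) / (q - 1)) * (c - p `^ (- q / (q - 1)))
   is also valid; the bound is approached when p and the critical exponent come
   together. The two definitions let respectively p (with q, M fixed) and M
   (with p, q fixed) vary. *)
Definition sharp_in_p (R : realType) (q M p0 : R) : Prop :=
  forall theta : R, theta < 1 ->
  \forall p \near p0^'+,
    exists2 phi, muckenhoupt_weight q M phi &
      ((theta * hardy_rhs p q M phi 1)%:E < hardy_lhs p phi 1)%E.

Definition sharp_in_M (R : realType) (q : R) : Prop :=
  forall p : R, 1 < p <= q -> forall theta : R, theta < 1 ->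
  exists M p0 phi, [/\ 1 <= M, critical_exponent q M p0, p0 < p,
    muckenhoupt_weight q M phi &
    ((theta * hardy_rhs p q M phi 1)%:E < hardy_lhs p phi 1)%E].

(* Main.v *)
Require Import Defs.
From HB Require Import structures.
From mathcomp Require Import all_boot all_order all_algebra.
From mathcomp Require Import all_classical all_reals all_analysis.
From mathcomp Require Import measurable_realfun ring lra.

Import Order.TTheory GRing.Theory Num.Theory.
Import numFieldNormedType.Exports.

Local Open Scope classical_set_scope.
Local Open Scope ring_scope.

(** Write u = 1/(q-1), v = 1/(p-1), c = M^u, and let F(s) and H(s) be the
    integrals of phi and phi^(-u) over [0,s), A(s) = F(s)/s. The hypothesis on
    phi reads H <= c s A^(-u), and the claim bounds the integral of A^(-v).

    The inequality comes from the function
      W(s) = H(s) A(s)^(u-v) - kappa s A(s)^(-v),   W(0) = 0.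
    Put phi = x A; then x >= 1 since phi is non-decreasing, s A' = (x-1) A, and
      W' = A^(-v) (x^(-u) - (v-u) (H A^u / s) (x-1) - kappa (1 + v - v x)).
    Here H A^u / s <= c, and x^(-u) lies above its tangent at x = p, the value
    of x for the power weight s^(p-1). This leaves an affine function of x;
    kappa is the number that cancels its slope, and what remains is K'. So
    W' >= K' A^(-v), and integrating,
      K' int_0^t A^(-v) <= W(t) <= (c - kappa) t A(t)^(-v).
    That (c - kappa)/K' is at most the stated constant amounts to K' >= 0
    ([hardy_constant_le]); K' > 0 is Bernoulli's inequality ([hardy_K_ge]).

    As phi may jump, the computation is done with increments: every derivative
    becomes a tangent-line inequality for a convex negative power
    ([energy_step], with [jensen_powRN] for the increment of H). The loss on an
    interval is its length times the decrement of a monotone function, and such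
    a loss disappears when the interval is halved repeatedly
    ([nondecreasing_of_slack]). This needs phi bounded, hence t < 1; the case
    t = 1 follows by continuity of the integrals ([hardy_le]). Because
    phi 0 > 0, nothing is singular at 0.

    For sharpness, the equation defining p0 says that the product of means of
    s^(p0-1) is constantly M. This weight vanishes at 0; replacing it on [0,e)
    by its mean over [0,e) keeps F unchanged beyond e and does not increase H
    there, so that the weight stays admissible ([extremal_muckenhoupt]). As e
    tends to 0, the quotient of the left-hand side by the right-hand side tends
    to a limit that is at least (p0-1)/(p-1) ([sharp_power]), and this bound
    tends to 1 both when p tends to p0 and when p0 tends to p. *)

Set Implicit Arguments.
Unset Strict Implicit.

(** * Powers with a negative exponent *)

Lemma eq_ler (R : realType) (x y : R) : x = y -> x <= y.
Proof. by move=> ->. Qed.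

Lemma bernoulli_powRN (R : realType) (r x : R) : 0 <= r -> 0 < x ->
  1 - r * (x - 1) <= x `^ (- r).
Proof.
move=> r0 x0; rewrite /powR gt_eqF//.
apply: le_trans (expR_ge1Dx _); rewrite mulNr lerD2l lerN2.
apply: ler_wpM2l => //.
by have := expR_ge1Dx (ln x); rewrite lnK ?posrE//; lra.
Qed.

Lemma powRD_gt0 (R : realType) (x r s : R) : 0 < x ->
  x `^ (r + s) = x `^ r * x `^ s.
Proof. by move=> x0; rewrite powRD// (gt_eqF x0) implybT. Qed.

Lemma powRS (R : realType) (r x : R) : 0 < x ->
  x `^ (- r) = x * x `^ (- (r + 1)).
Proof.
move=> x0; rewrite -[X in X * _](powRr1 (ltW x0)) -powRD_gt0//.
by congr (_ `^ _); ring.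
Qed.

Lemma powRN_tangent (R : realType) (r x y : R) : 0 <= r -> 0 < x -> 0 < y ->
  x `^ (- r) - r * x `^ (- (r + 1)) * (y - x) <= y `^ (- r).
Proof.
move=> r0 x0 y0.
have := bernoulli_powRN r0 (divr_gt0 y0 x0).
move=> /(ler_wpM2l (powR_ge0 x (- r))).
have x0' := ltW x0; have yx0 := divr_ge0 (ltW y0) x0'.
rewrite -powRM// (mulrC y) mulVKf ?gt_eqF//.
apply: le_trans; rewrite powRS//; apply: eq_ler.
by field; rewrite gt_eqF.
Qed.

Lemma nincr_powRN (R : realType) (r x y : R) : 0 <= r -> 0 < x -> x <= y ->
  y `^ (- r) <= x `^ (- r).
Proof.
move=> r0 x0 xy; rewrite !powRN lef_pV2 ?posrE ?powR_gt0//; last first.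
  exact: lt_le_trans xy.
by rewrite ge0_ler_powR// ?nnegrE ltW// (lt_le_trans x0).
Qed.

(** * The energy inequality for increments *)

Section energy_inequality.
Context (R : realType).
Variables (p u v c : R).
Hypotheses (p1 : 1 <= p) (u0 : 0 <= u) (uv : u <= v).
Hypotheses (vp : v * (p - 1) = 1) (c0 : 0 <= c).

Let P := p `^ (- (u + 1)).
Let kappa := u * (p - 1) * P + c * (1 - u * (p - 1)).
Let K := p `^ (- u) - c * (1 - u * (p - 1)).

(** The function W above. Here [kappa] is the number that cancels the slope in m
    of the lower bound for the increments of W. *)
Definition energy (H A s : R) :=
  H * A `^ (- (v - u)) - kappa * (s * A `^ (- v)).

Lemma exponent_ratio_le1 : u * (p - 1) <= 1.
Proof. by rewrite -[X in _ <= X]vp ler_wpM2r// subr_ge0. Qed.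

Lemma kappa_ge0 : 0 <= kappa.
Proof.
rewrite addr_ge0// mulr_ge0 ?subr_ge0 ?exponent_ratio_le1 ?powR_ge0//.
by rewrite mulr_ge0// subr_ge0.
Qed.

(** The increment form of W' >= K' A^(-v). Primed letters are values at s', and
    m is the mean of phi over [s,s'), so that s (A' - A) = (s' - s) (m - A').
    Three convex powers are replaced by tangents: A^(u-v) at A, A^(-v) at A',
    and m^(-u) at p A'. The first two are taken at different ends, and the
    resulting difference of A^(-v-1) and A'^(-v-1) is the error term; it is
    stated with m in place of m - A', which only enlarges it. *)
Lemma energy_step (s s' A A' H H' m : R) :
  0 <= s -> s <= s' -> 0 < A -> A <= A' -> A' <= m ->
  s' * A' - s * A = m * (s' - s) ->
  0 <= H -> H <= c * (s * A `^ (- u)) ->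
  (s' - s) * m `^ (- u) <= H' - H ->
  K * ((s' - s) * A' `^ (- v))
    - c * (v - u) * ((s' - s) * m) * (A `^ (- (v + 1)) - A' `^ (- (v + 1)))
  <= energy H' A' s' - energy H A s.
Proof.
move=> s0 ss' A0 AA' A'm Em H0 HA Hm.
have A'0 : 0 < A' by exact: lt_le_trans AA'.
have m0 : 0 < m by exact: lt_le_trans A'm.
have p0 : 0 < p by exact: lt_le_trans p1.
have r0 : 0 <= v - u by rewrite subr_ge0.
have v0 : 0 <= v by exact: le_trans uv.
have T1 := powRN_tangent r0 A0 A'0.
have T2 := powRN_tangent v0 A'0 A0.
have T3 := powRN_tangent u0 (mulr_gt0 p0 A'0) m0.
have PuE : p `^ (- u) = p * P by exact: powRS.
rewrite !powRM ?(ltW p0) ?(ltW A'0)// PuE in T3.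
have E1 : A' `^ (- v) = A' * A' `^ (- (v + 1)) by exact: powRS.
have E2 : A' `^ (- u) * A' `^ (- (v - u)) = A' * A' `^ (- (v + 1)).
  by rewrite -E1 -powRD_gt0//; congr (_ `^ _); ring.
have E3 : A' `^ (- (u + 1)) * A' `^ (- (v - u)) = A' `^ (- (v + 1)).
  by rewrite -powRD_gt0//; congr (_ `^ _); ring.
have E4 : A `^ (- u) * A `^ (- (v - u + 1)) = A `^ (- (v + 1)).
  by rewrite -powRD_gt0//; congr (_ `^ _); ring.
have ba : A' `^ (- (v + 1)) <= A `^ (- (v + 1)).
  by apply: nincr_powRN => //; rewrite addr_ge0.
have k0 := kappa_ge0.
rewrite /energy /K PuE E1.
rewrite E1 in T2.
have kv : kappa * v = u * P + c * (v - u).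
  rewrite /kappa.
  transitivity (u * P * (v * (p - 1)) + c * (v - u * (v * (p - 1)))).
    by ring.
  by rewrite vp; ring.
(* The tangent to m^(-u) at p A', multiplied by A'^(u-v). *)
have B1 : (s' - s) * ((1 + u) * p * P * (A' * A' `^ (- (v + 1)))
      - u * P * A' `^ (- (v + 1)) * m) <= (H' - H) * A' `^ (- (v - u)).
  apply: le_trans (ler_wpM2r (powR_ge0 _ _) Hm).
  rewrite -[X in _ <= X]mulrA; apply: ler_wpM2l; first by rewrite subr_ge0.
  apply: le_trans (ler_wpM2r (powR_ge0 _ _) T3).
  rewrite -E2 -E3 -/P; apply: eq_ler.
  by rewrite [A' `^ (- u)]powRS//; ring.
have sA : s * (A' - A) = (s' - s) * (m - A') by move: Em; lra.
(* Since A^(u-v) decreases, H may be replaced by its bound c s A^(-u). *)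
have B2 : - (c * (v - u) * A `^ (- (v + 1)) * ((s' - s) * (m - A'))) <=
   H * (A' `^ (- (v - u)) - A `^ (- (v - u))).
  have : H * (- ((v - u) * A `^ (- (v - u + 1)) * (A' - A))) <=
      H * (A' `^ (- (v - u)) - A `^ (- (v - u))).
    by apply: ler_wpM2l => //; move: T1; lra.
  apply: le_trans; rewrite mulrN lerN2 -sA -E4.
  have := ler_wpM2r (_ : 0 <= (v - u) * A `^ (- (v - u + 1)) * (A' - A)) HA.
  move=> /(_ _) => HH; apply: le_trans (HH _) _.
    by rewrite mulr_ge0 ?subr_ge0// mulr_ge0// powR_ge0.
  by apply: eq_ler; ring.
have B3 : kappa * (s' * (A' * A' `^ (- (v + 1))) - s * A `^ (- v)) <=
   (s' - s) * (kappa * (A' * A' `^ (- (v + 1)))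
      - kappa * v * A' `^ (- (v + 1)) * (m - A')).
  have := ler_wpM2l k0 (ler_wpM2l s0 T2).
  have -> : kappa *
      (s * (A' * A' `^ (- (v + 1)) - v * A' `^ (- (v + 1)) * (A - A'))) =
      kappa * s * (A' * A' `^ (- (v + 1)))
      + kappa * v * A' `^ (- (v + 1)) * (s * (A' - A)) by ring.
  rewrite sA; lra.
rewrite kv in B3.
have B4 : 0 <= c * (v - u) * (s' - s) * A' *
     (A `^ (- (v + 1)) - A' `^ (- (v + 1))).
  by rewrite !mulr_ge0 ?subr_ge0// ltW.
move: B1 B2 B3 B4; rewrite /kappa.
set a := A' `^ (- (v + 1)); set b := A `^ (- (v + 1)); move=> B1 B2 B3 B4.
have vpu : u * P * (A' * a) * (v * (p - 1)) = u * P * (A' * a).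
  by rewrite vp mulr1.
lra.
Qed.

End energy_inequality.

(** Halving an interval halves the length and splits the decrement of [psi]
    additively, so the total loss over the pieces is halved as well. *)
Lemma nondecreasing_of_slack (R : realType) (f psi : R -> R) (a b : R) :
  (forall x y, a <= x -> x <= y -> y <= b ->
    - ((y - x) * (psi x - psi y)) <= f y - f x) ->
  a <= b -> f a <= f b.
Proof.
move=> step ab.
have half n : forall x y, a <= x -> x <= y -> y <= b ->
    - ((y - x) * (psi x - psi y) / 2 ^+ n) <= f y - f x.
  elim: n => [|n IH] x y ax xy yb; first by rewrite expr0 divr1 step.
  have xz : x <= (x + y) / 2 by lra.
  have zy : (x + y) / 2 <= y by lra.
  have := IH _ _ ax xz (le_trans zy yb); have := IH _ _ (le_trans ax xz) zy yb.
  rewrite exprS; set w := 2 ^+ n.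
  have -> : (2 * w)^-1 = w^-1 / 2 by rewrite invfM mulrC.
  set z := (x + y) / 2.
  have -> : (y - z) = (y - x) / 2 by rewrite /z; field.
  have -> : (z - x) = (y - x) / 2 by rewrite /z; field.
  lra.
rewrite -subr_ge0 -oppr_le0; apply/ler_addgt0Pr => e e0; rewrite add0r.
set C := (b - a) * (psi a - psi b).
have [n ltn] : exists n, `|C| / e < 2 ^+ n.
  exists (Num.trunc (`|C| / e)).+1.
  apply: lt_le_trans (_ : (Num.trunc (`|C| / e)).+1%:R <= _).
    by rewrite truncnS_gt.
  by rewrite -natrX ler_nat ltnW// ltn_expl.
have w0 : 0 < (2:R) ^+ n by rewrite exprn_gt0.
have := half n a b (lexx _) ab (lexx _); rewrite -/C => h.
rewrite lerNl (le_trans _ h)// lerN2 ler_pdivrMr// (le_trans (ler_norm _))//.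
by rewrite mulrC -ler_pdivrMr// ltW.
Qed.

Section hardy_abstract.
Context (R : realType).
Variables (p u v c : R).
Hypotheses (p1 : 1 <= p) (u0 : 0 <= u) (uv : u <= v).
Hypotheses (vp : v * (p - 1) = 1) (c0 : 0 <= c).

Let P := p `^ (- (u + 1)).
Let K := p `^ (- u) - c * (1 - u * (p - 1)).

(** The function f = W - K' G satisfies f 0 <= f t, because its increments are
    non-negative up to the errors of [energy_step] and of the bound
    G s' - G s <= (s' - s) A(s)^(-v), and both errors are the length of the
    interval times the decrement of a power of A. The bound B on the means m is
    what makes the first one of this form. The value A 0 is free up to
    positivity and monotonicity: it enters W only multiplied by s = 0. *)
Lemma hardy_bounded (A H G : R -> R) (t B : R) :
  0 <= t -> 0 <= K ->
  (forall s, 0 <= s <= t -> 0 < A s) ->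
  (forall s s', 0 <= s -> s <= s' -> s' <= t -> A s <= A s') ->
  H 0 = 0 ->
  (forall s, 0 <= s <= t -> 0 <= H s <= c * (s * A s `^ (- u))) ->
  (forall s s', 0 <= s -> s < s' -> s' <= t ->
    let m := (s' * A s' - s * A s) / (s' - s) in
    [/\ m <= B, (s' - s) * m `^ (- u) <= H s' - H s &
        G s' - G s <= (s' - s) * A s `^ (- v)]) ->
  K * (G t - G 0) <= u * (p - 1) * (c - P) * (t * A t `^ (- v)).
Proof.
move=> t0 K0 Apos Amono H0 HA step.
have v0 : 0 <= v by exact: le_trans uv.
pose f s := energy p u v c (H s) (A s) s - K * G s.
pose psi s := c * (v - u) * B * A s `^ (- (v + 1)) + K * A s `^ (- v).
have : f 0 <= f t.
  apply: (@nondecreasing_of_slack _ f psi) => // x y x0 xy yt.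
  move: xy; rewrite le_eqVlt => /predU1P[->|xy].
    by rewrite !subrr mul0r oppr0.
  have [mB mH mG] := step _ _ x0 xy yt.
  set m := (y * A y - x * A x) / (y - x) in mB mH mG.
  have xt : 0 <= x <= t by rewrite x0 (le_trans (ltW xy)).
  have yt' : 0 <= y <= t by rewrite (le_trans x0 (ltW xy)).
  have Ax := Apos _ xt; have Ay := Apos _ yt'.
  have Axy := Amono _ _ x0 (ltW xy) yt.
  have d0 : 0 < y - x by rewrite subr_gt0.
  have mE : y * A y - x * A x = m * (y - x) by rewrite divfK// gt_eqF.
  have Aym : A y <= m.
    rewrite ler_pdivlMr//; have := ler_wpM2l x0 Axy; lra.
  have /andP[Hx0 HxA] := HA _ xt.
  have E := energy_step p1 u0 uv vp c0 x0 (ltW xy) Ax Axy Aym mE Hx0 HxA mH.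
  have b1 : A y `^ (- (v + 1)) <= A x `^ (- (v + 1)).
    by apply: nincr_powRN => //; rewrite addr_ge0.
  have Q0 : 0 <= c * (v - u) * (y - x) *
      (A x `^ (- (v + 1)) - A y `^ (- (v + 1))).
    by rewrite !mulr_ge0 ?subr_ge0// ltW.
  have := ler_wpM2l Q0 mB.
  have := ler_wpM2l K0 mG.
  rewrite /f /psi; move: E; rewrite -/K; lra.
rewrite /f /energy H0 !mul0r mulr0 subr0 sub0r -/P.
have tt : 0 <= t <= t by rewrite t0 lexx.
have /andP[_ HtA] := HA _ tt.
have := ler_wpM2r (powR_ge0 (A t) (- (v - u))) HtA.
have -> : c * (t * A t `^ (- u)) * A t `^ (- (v - u)) = c * (t * A t `^ (- v)).
  rewrite -!mulrA -powRD_gt0 ?Apos//; congr (_ * (_ * _ `^ _)); ring.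
by rewrite -/P; lra.
Qed.

End hardy_abstract.

(** * Integrals over half-open intervals *)

Lemma nondecreasing_in_measurable (R : realType) (D : interval R) (f : R -> R) :
  {in D &, {homo f : x y / x <= y}} -> measurable_fun [set` D] f.
Proof.
move=> f_nd; apply: (measurability (@RGenCInfty.G R)) => [|/= _ [_] [r] -> <-].
  exact: RGenCInfty.measurableE.
move=> mD; apply: is_interval_measurable => s t /= [Ds fs] [Dt ft] z szt.
have Dz : z \in D by exact: (interval_is_interval Ds Dt).
split => //; move: fs; rewrite !in_itv/= !andbT => /le_trans; apply.
by apply: f_nd => //; case/andP: szt.
Qed.

Lemma nonincreasing_in_measurable (R : realType) (D : interval R) (f : R -> R) :
  {in D &, {homo f : x y /~ x <= y}} -> measurable_fun [set` D] f.
Proof.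
move=> f_ni; rewrite -(opprK f); apply/measurable_funN.
by apply: nondecreasing_in_measurable => x y Dx Dy xy; rewrite lerN2 f_ni.
Qed.

Section half_open.
Context (R : realType).
Notation mu := (@lebesgue_measure R).
Implicit Types (a b c k : R) (f : R -> R).

Lemma integrable_bounded_itv a b f k :
  measurable_fun `[a, b[ f -> {in `[a, b[, forall x, 0 <= f x <= k} ->
  mu.-integrable `[a, b[ (EFin \o f).
Proof.
move=> mf fk; apply: measurable_bounded_integrable => //=.
  by rewrite lebesgue_measure_itv/=; case: ifPn => // _; rewrite -EFinB ltry.
exists k; split; first exact: num_real.
move=> r kr x /= xab; have /andP[f0 fk'] := fk x xab.
by rewrite ger0_norm// (le_trans fk')// ltW.
Qed.

Lemma integrable_sub_itv a b a' b' f : a <= a' -> b' <= b ->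
  mu.-integrable `[a, b[ (EFin \o f) -> mu.-integrable `[a', b'[ (EFin \o f).
Proof.
move=> aa bb; apply: integrableS => //; apply: subset_itv; rewrite bnd_simp//.
Qed.

Lemma Rintegral_itv_split a b c f : a <= b -> b <= c ->
  mu.-integrable `[a, c[ (EFin \o f) ->
  \int[mu]_(x in `[a, c[) f x =
  \int[mu]_(x in `[a, b[) f x + \int[mu]_(x in `[b, c[) f x.
Proof.
move=> ab bc fi.
rewrite (@itv_bndbnd_setU _ _ _ (BLeft b)) ?bnd_simp// Rintegral_setU//.
  by rewrite -itv_bndbnd_setU ?bnd_simp.
apply/disj_setPS => y [/=]; rewrite 2!in_itv/= => /andP[_ yx] /andP[].
by rewrite leNgt yx.
Qed.

Lemma Rintegral_itv_cst a b k : a <= b ->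
  \int[mu]_(x in `[a, b[) k = k * (b - a).
Proof.
move=> ab; rewrite Rintegral_cst//= lebesgue_measure_itv/= lte_fin.
move: ab; rewrite le_eqVlt => /predU1P[->|->]; first by rewrite ltxx subrr.
by rewrite -EFinB.
Qed.

Lemma integrable_itv_cst a b k : mu.-integrable `[a, b[ (EFin \o cst k).
Proof.
apply: measurable_bounded_integrable => //=; last exact: bounded_cst.
by rewrite lebesgue_measure_itv/=; case: ifPn => // _; rewrite -EFinB ltry.
Qed.

Lemma Rintegral_itv_le_cst a b f k : a <= b ->
  mu.-integrable `[a, b[ (EFin \o f) -> {in `[a, b[, forall x, f x <= k} ->
  \int[mu]_(x in `[a, b[) f x <= k * (b - a).
Proof.
move=> ab fi fk; rewrite -Rintegral_itv_cst//.
by apply: le_Rintegral => //; exact: integrable_itv_cst.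
Qed.

Lemma Rintegral_itv_ge_cst a b f k : a <= b ->
  mu.-integrable `[a, b[ (EFin \o f) -> {in `[a, b[, forall x, k <= f x} ->
  k * (b - a) <= \int[mu]_(x in `[a, b[) f x.
Proof.
move=> ab fi fk; rewrite -Rintegral_itv_cst//.
by apply: le_Rintegral => //; exact: integrable_itv_cst.
Qed.

(** Integrate the tangent-line inequality of x^(-u) at the mean of f. *)
Lemma jensen_powRN a b f u : a < b -> 0 <= u ->
  {in `[a, b[, forall x, 0 < f x} ->
  mu.-integrable `[a, b[ (EFin \o f) ->
  mu.-integrable `[a, b[ (EFin \o (fun x => f x `^ (- u))) ->
  0 < \int[mu]_(x in `[a, b[) f x ->
  (b - a) * ((\int[mu]_(x in `[a, b[) f x) / (b - a)) `^ (- u) <=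
  \int[mu]_(x in `[a, b[) f x `^ (- u).
Proof.
move=> ab u0 f0 fi hi F0.
set F := \int[mu]_(x in `[a, b[) f x in F0 *.
have d0 : 0 < b - a by rewrite subr_gt0.
set m := F / (b - a); have m0 : 0 < m by rewrite divr_gt0.
set k := u * m `^ (- (u + 1)).
have ki : mu.-integrable `[a, b[ (EFin \o (fun x => k * f x)).
  have := @integrableZl _ _ _ mu `[a, b[ (measurable_itv _) k _ fi.
  by apply: eq_integrable.
have ci : mu.-integrable `[a, b[ (EFin \o (fun=> m `^ (- u) + k * m)).
  exact: integrable_itv_cst.
have li : mu.-integrable `[a, b[
    (EFin \o (fun x => (m `^ (- u) + k * m) - k * f x)).
  exact: (integrableB _ ci ki).
apply: (@le_trans _ _ (\int[mu]_(x in `[a, b[) (m `^ (- u) + k * m - k * f x))).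
  rewrite RintegralB// RintegralZl// Rintegral_itv_cst ?(ltW ab)// -/F.
  have -> : F = m * (b - a) by rewrite divfK// gt_eqF.
  apply: eq_ler; ring.
apply: le_Rintegral => // x xab.
by have := powRN_tangent u0 m0 (f0 _ xab); rewrite -/k; lra.
Qed.

Lemma integrable_itv_cc a b f :
  mu.-integrable `[a, b[ (EFin \o f) -> mu.-integrable `[a, b] (EFin \o f).
Proof.
move=> /integrableP[mf foo]; apply/integrableP; split.
  exact/emeasurable_fun_itv_bndo_bndcP.
by rewrite -integral_itv_bndo_bndc//; exact: measurableT_comp.
Qed.

Lemma Rintegral_itv_left_cvg a b f : a < b ->
  mu.-integrable `[a, b[ (EFin \o f) ->
  \int[mu]_(x in `[a, t[) f x @[t --> b^'-] --> \int[mu]_(x in `[a, b[) f x.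
Proof.
move=> ab fi; rewrite Rintegral_itv_bndo_bndc//.
apply: cvg_trans (parameterized_integral_cvg_at_left ab (integrable_itv_cc fi)).
apply: near_eq_cvg; near=> t.
rewrite /parameterized_integral Rintegral_itv_bndo_bndc//.
by apply: integrable_sub_itv fi => //.
Unshelve. all: by end_near. Qed.

End half_open.

(** * The constants *)

Lemma critical_constant (R : realType) (q M p0 : R) : 1 <= M ->
  critical_exponent q M p0 ->
  M `^ (q - 1)^-1 = p0 `^ (- (q - 1)^-1) * ((q - 1) / (q - p0)).
Proof.
move=> M1 [/andP[p01 p0q] E].
have M0 : 0 <= M by rewrite (le_trans _ M1).
have p00 : 0 < p0 by rewrite (lt_trans _ p01).
have x0 : p0 `^ (q - 1)^-1 != 0 by rewrite gt_eqF// powR_gt0.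
move: E; rewrite powRM ?(ltW p00)// powRN => E.
have {}E : M `^ (q - 1)^-1 * ((q - p0) / (q - 1)) * p0 `^ (q - 1)^-1 = 1.
  by apply: etrans E; ring.
have h1 : q - p0 != 0 by rewrite subr_eq0 gt_eqF.
have h2 : q - 1 != 0 by rewrite subr_eq0 gt_eqF// (lt_trans p01).
apply: (mulIf x0); apply: (mulIf (mulf_neq0 h1 (invr_neq0 h2))).
transitivity (1 : R); first by apply: etrans E; ring.
by field; rewrite h1 h2.
Qed.

(** K' vanishes at p = p0, and Bernoulli's inequality applied to (p0/p)^u
    bounds it below by its tangent there. The bound gives K' > 0 and also, being
    of first order in p - p0, the sharpness. *)
Lemma hardy_K_ge (R : realType) (q p0 p c : R) :
  1 < p0 -> p0 < q -> p0 < p ->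
  c = p0 `^ (- (q - 1)^-1) * ((q - 1) / (q - p0)) ->
  c * ((p - p0) * (q * (p0 - 1)) / ((q - 1) ^+ 2 * p0)) <= hardy_K p q c.
Proof.
move=> p01 p0q p0p cE.
have p00 : 0 < p0 by rewrite (lt_trans _ p01).
have pp : 0 < p by rewrite (lt_trans p00).
have h1 : q - p0 != 0 by rewrite subr_eq0 gt_eqF.
have h2 : q - 1 != 0 by rewrite subr_eq0 gt_eqF// (lt_trans p01).
have h3 : p0 != 0 by rewrite gt_eqF.
have u0 : 0 <= (q - 1)^-1 by rewrite invr_ge0 subr_ge0 ltW// (lt_trans p01).
rewrite /hardy_K -powRN.
have e : p0 `^ (- (q - 1)^-1) = c * ((q - p0) / (q - 1)).
  by rewrite cE; field; rewrite h1 h2.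
have := powRN_tangent u0 p00 pp.
have -> : p0 `^ (- ((q - 1)^-1 + 1)) = p0 `^ (- (q - 1)^-1) / p0.
  by rewrite [X in _ = X / _]powRS//; field.
rewrite e -(lerD2r (- (c * ((q - p) / (q - 1))))); apply: le_trans.
apply: eq_ler.
by field; rewrite h2 h3.
Qed.

(** The left-hand side is the constant (c - kappa)/K' that the energy argument
    yields. Multiplied by K', the two sides differ by a non-negative multiple
    of K'. *)
Lemma hardy_constant_le (R : realType) (q p c : R) :
  1 < p -> p <= q -> 0 <= c -> 0 < hardy_K p q c ->
  (hardy_K p q c)^-1 *
    ((q - 1)^-1 * (p - 1) * (c - p `^ (- ((q - 1)^-1 + 1)))) <=
  (hardy_K p q c)^-1 * c * (q / p) * ((p - 1) / (q - 1)) ^+ 2.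
Proof.
move=> p1 pq c0 K0.
have h2 : q - 1 != 0 by rewrite subr_eq0 gt_eqF// (lt_le_trans p1).
have q1 : 0 < q - 1 by rewrite subr_gt0 (lt_le_trans p1).
have pp : 0 < p by rewrite (lt_trans _ p1).
have h3 : p != 0 by rewrite gt_eqF.
rewrite -!mulrA; apply: ler_wpM2l; first by rewrite invr_ge0 ltW.
set P := p `^ _.
have KE : hardy_K p q c = p * P - c * ((q - p) / (q - 1)).
  by rewrite /hardy_K -powRN powRS.
have : 0 <= (q - 1)^-1 * (p - 1) / p * hardy_K p q c.
  by rewrite !mulr_ge0 ?invr_ge0 ?(ltW pp) ?(ltW q1) ?(ltW K0)// subr_ge0 ltW.
rewrite KE -subr_ge0 => h; rewrite -subr_ge0; apply: (le_trans h).
rewrite subr0; apply: eq_ler.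
by field; rewrite h2 h3.
Qed.

(** * The inequality for a weight *)

Lemma meanE (R : realType) (f : R -> R) (t : R) :
  lebesgue_measure.-integrable `[0, t[ (EFin \o f) ->
  mean f t = ((\int[lebesgue_measure]_(x in `[0, t[) f x) / t)%:E.
Proof.
move=> fi; rewrite /mean EFinM muleC; congr (_ * _)%E.
by rewrite fineK//; exact: integrable_fin_num.
Qed.

(** The value at 0 is chosen to keep the function positive and non-decreasing on
    [0,1]. *)
Definition running_mean (R : realType) (phi : R -> R) (s : R) : R :=
  if s == 0 then phi 0 else (\int[lebesgue_measure]_(x in `[0, s[) phi x) / s.

Section weight.
Context (R : realType).
Variables (q M : R) (phi : R -> R).
Hypotheses (q1 : 1 < q) (M1 : 1 <= M) (wphi : muckenhoupt_weight q M phi).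
Notation mu := (@lebesgue_measure R).
Let u := (q - 1)^-1.
Let h y := phi y `^ (- u).

Let zero_in : (0 : R) \in `[0, 1[.
Proof. by rewrite in_itv/= lexx ltr01. Qed.

Lemma dual_exponent_gt0 : 0 < u. Proof. by rewrite invr_gt0 subr_gt0. Qed.

Lemma weight_at0_gt0 : 0 < phi 0. Proof. by case: wphi => + _ _; exact. Qed.

Lemma weight_ge_at0 x : x \in `[0, 1[ -> phi 0 <= phi x.
Proof.
case: wphi => _ + _ x01; apply => //.
by move: x01; rewrite in_itv/= => /andP[].
Qed.

Lemma weight_gt0 x : x \in `[0, 1[ -> 0 < phi x.
Proof. by case: wphi => + _ _; exact. Qed.

Lemma measurable_weight : measurable_fun `[(0:R), 1[ phi.
Proof. by apply: nondecreasing_in_measurable; case: wphi. Qed.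

Lemma integrable_dual : mu.-integrable `[(0:R), 1[ (EFin \o h).
Proof.
apply: (@integrable_bounded_itv _ _ _ _ (phi 0 `^ (- u))).
  apply: nonincreasing_in_measurable => x y x01 y01 xy.
  apply: nincr_powRN; rewrite ?(ltW dual_exponent_gt0) ?weight_gt0//.
  by case: wphi => _ + _; exact.
move=> x x01; rewrite powR_ge0 nincr_powRN ?(ltW dual_exponent_gt0)//.
  exact: weight_at0_gt0.
exact: weight_ge_at0.
Qed.

Let H t := \int[mu]_(x in `[0, t[) h x.
Let F t := \int[mu]_(x in `[0, t[) phi x.

Lemma integrable_dual_sub a b : 0 <= a -> b <= 1 ->
  mu.-integrable `[a, b[ (EFin \o h).
Proof. by move=> a0 b1; apply: integrable_sub_itv integrable_dual. Qed.

Lemma dual_gt0 : 0 < H 1.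
Proof.
have h0 : (0:R) <= 2^-1 by lra.
have h1 : (2^-1:R) <= 1 by lra.
rewrite /H (Rintegral_itv_split h0 h1 integrable_dual).
have k0 : 2^-1 \in `[(0:R), 1[ by rewrite in_itv/= h0/=; lra.
apply: (@lt_le_trans _ _ (phi 2^-1 `^ (- u) * (2^-1 - 0))).
  by rewrite subr0 mulr_gt0 ?powR_gt0 ?weight_gt0//; lra.
rewrite -[X in X <= _]addr0; apply: lerD.
  (* phi^(-u) is non-increasing, so on [0,1/2) it is at least phi(1/2)^(-u). *)
  apply: Rintegral_itv_ge_cst => //; first exact: integrable_dual_sub.
  move=> x; rewrite in_itv/= => /andP[x0 x2].
  have x01 : x \in `[(0:R), 1[ by rewrite in_itv/= x0/= (lt_le_trans x2).
  apply: nincr_powRN; rewrite ?(ltW dual_exponent_gt0) ?weight_gt0//.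
  by case: wphi => _ + _; apply => //; rewrite ltW.
by apply: Rintegral_ge0 => x _; exact: powR_ge0.
Qed.

(** The dual mean at t = 1 is finite and positive, so an infinite mean of phi
    would make the product infinite. *)
Lemma integrable_weight : mu.-integrable `[(0:R), 1[ (EFin \o phi).
Proof.
case: wphi => _ _ /(_ 1); rewrite ltr01 lexx => /(_ isT).
rewrite [mean (fun _ => _ `^ _) _]meanE; last exact: integrable_dual.
rewrite -/(H 1) divr1 poweR_EFin /mean invr1 mul1e => hM.
apply/integrableP; split.
  by apply/measurable_EFinP; exact: measurable_weight.
have -> : (\int[mu]_(x in `[0%R, 1%R[) `|(EFin \o phi) x| =
   \int[mu]_(x in `[0%R, 1%R[) (phi x)%:E)%E.
  apply: eq_integral => x; rewrite inE/= => x01.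
  by rewrite ger0_norm// ltW// weight_gt0.
rewrite ltey; apply/eqP => foo; move: hM.
by rewrite foo gt0_mulye ?lte_fin ?powR_gt0 ?dual_gt0// leNgt ltey.
Qed.

Lemma integrable_weight_sub a b : 0 <= a -> b <= 1 ->
  mu.-integrable `[a, b[ (EFin \o phi).
Proof. by move=> a0 b1; apply: integrable_sub_itv integrable_weight. Qed.

Lemma weight_incr_ge s s' : 0 <= s -> s < s' -> s' <= 1 ->
  phi s * (s' - s) <= \int[mu]_(x in `[s, s'[) phi x.
Proof.
move=> s0 ss' s'1; apply: Rintegral_itv_ge_cst; first exact: ltW.
  exact: integrable_weight_sub.
move=> x; rewrite in_itv/= => /andP[sx xs'].
case: wphi => _ + _; apply => //; rewrite in_itv/=.
  by rewrite s0 (lt_le_trans ss').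
by rewrite (le_trans s0 sx) (lt_le_trans xs').
Qed.

Lemma weight_incr_le s s' : 0 <= s -> s <= s' -> s' < 1 ->
  \int[mu]_(x in `[s, s'[) phi x <= phi s' * (s' - s).
Proof.
move=> s0 ss' s'1; apply: Rintegral_itv_le_cst => //.
  by apply: integrable_weight_sub => //; exact: ltW.
move=> x; rewrite in_itv/= => /andP[sx xs'].
case: wphi => _ + _; apply; rewrite ?in_itv/=.
- by rewrite (le_trans s0 sx) (lt_trans xs').
- by rewrite (le_trans s0 ss').
- exact: ltW.
Qed.

Lemma primitive_split s s' : 0 <= s -> s <= s' -> s' <= 1 ->
  F s' = F s + \int[mu]_(x in `[s, s'[) phi x.
Proof.
move=> s0 ss' s'1; apply: Rintegral_itv_split => //.
exact: integrable_weight_sub.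
Qed.

Lemma dual_primitive_split s s' : 0 <= s -> s <= s' -> s' <= 1 ->
  H s' = H s + \int[mu]_(x in `[s, s'[) h x.
Proof.
move=> s0 ss' s'1; apply: Rintegral_itv_split => //.
exact: integrable_dual_sub.
Qed.

Let A := running_mean phi.

Lemma primitiveE s : F s = s * A s.
Proof.
rewrite /A /running_mean; case: eqVneq => [->|s0]; last by rewrite mulrC divfK.
by rewrite mul0r /F set_itv_ge ?Rintegral_set0// bnd_simp ltxx.
Qed.

Lemma running_mean_le s s' : 0 <= s -> s <= s' -> s' <= 1 -> A s <= A s'.
Proof.
move=> s0; rewrite le_eqVlt => /predU1P[->//|ss'] s'1.
have s'0 : 0 < s' by exact: le_lt_trans ss'.
have d0 : 0 < s' - s by rewrite subr_gt0.
have As : A s <= phi s.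
  have ps : phi 0 <= phi s.
    by rewrite weight_ge_at0// in_itv/= s0 (lt_le_trans ss').
  rewrite /A /running_mean; case: eqVneq => // sn0.
  have sp : 0 < s by rewrite lt_neqAle eq_sym sn0.
  rewrite ler_pdivrMr//.
  have := @weight_incr_le 0 s (lexx _) s0 (lt_le_trans ss' s'1).
  by rewrite subr0.
rewrite -(ler_pM2l s'0) -primitiveE.
rewrite (primitive_split s0 (ltW ss') s'1) primitiveE.
have := weight_incr_ge s0 ss' s'1.
have := ler_wpM2r (ltW d0) As; lra.
Qed.

Lemma running_mean_gt0 s : 0 <= s -> s <= 1 -> 0 < A s.
Proof.
move=> s0 s1; apply: lt_le_trans (running_mean_le (lexx 0) s0 s1).
by rewrite /A /running_mean eqxx weight_at0_gt0.
Qed.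

Lemma fine_mean_running s : 0 < s -> s <= 1 -> fine (mean phi s) = A s.
Proof.
move=> s0 s1; rewrite meanE; last exact: integrable_weight_sub.
by rewrite /A /running_mean gt_eqF.
Qed.

Lemma weight_dual_le s : 0 <= s <= 1 ->
  0 <= H s <= M `^ u * (s * A s `^ (- u)).
Proof.
move=> /andP[+ s1]; rewrite le_eqVlt => /predU1P[<-|s0].
  by rewrite mul0r mulr0 /H set_itv_ge ?Rintegral_set0 ?lexx// bnd_simp ltxx.
have H0 : 0 <= H s by apply: Rintegral_ge0 => x _; exact: powR_ge0.
rewrite H0/=.
have As := running_mean_gt0 (ltW s0) s1.
case: wphi => _ _ /(_ s); rewrite s0 s1 => /(_ isT).
rewrite [mean (fun _ => _ `^ _) _]meanE; last exact: integrable_dual_sub.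
rewrite meanE; last exact: integrable_weight_sub.
rewrite poweR_EFin lee_fin -/(H s) -/(F s).
have -> : F s / s = A s by rewrite /A /running_mean gt_eqF.
move=> hM.
have Hs : 0 <= H s / s by rewrite divr_ge0// ltW.
have M0 : 0 <= M by rewrite (le_trans _ M1).
have : (H s / s) `^ (q - 1) <= M / A s by rewrite ler_pdivlMr// mulrC.
move=> /(ge0_ler_powR (ltW dual_exponent_gt0)).
rewrite !nnegrE powR_ge0 divr_ge0 ?(ltW As)// => /(_ isT isT).
rewrite -powRrM mulfV ?subr_eq0 ?gt_eqF// powRr1//.
rewrite powRM ?invr_ge0 ?(ltW As)// -powR_inv1 ?(ltW As)// -powRrM mulN1r.
by rewrite ler_pdivrMr// -mulrA [X in _ * X]mulrC.
Qed.

Section exponent.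
Variable p : R.
Hypotheses (p1 : 1 < p) (pq : p <= q) (K0 : 0 < hardy_K p q (M `^ u)).
Let v := (p - 1)^-1.
Let g s := fine (mean phi s) `^ (- v).
Let G t := \int[mu]_(x in `[0, t[) g x.

Let v_gt0 : 0 < v. Proof. by rewrite invr_gt0 subr_gt0. Qed.

Let uv : u <= v.
Proof. by rewrite lef_pV2 ?posrE ?subr_gt0// lerD2r. Qed.

(** At x = 0 the integrand is 0 by the conventions on division and powers, so
    that the bound holds there too. *)
Lemma hardy_integrand_le a x : 0 <= a -> a <= x -> x < 1 -> g x <= A a `^ (- v).
Proof.
move=> a0 ax x1; rewrite /g.
have [x0|x0] := eqVneq x 0.
  by rewrite x0 /mean invr0 mul0e /= powR0 ?powR_ge0// oppr_eq0 gt_eqF.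
have xp : 0 < x by rewrite lt_neqAle eq_sym x0 (le_trans a0).
rewrite fine_mean_running// ?(ltW x1)// nincr_powRN ?(ltW v_gt0)//.
  by rewrite running_mean_gt0// (le_trans ax)// ltW.
by rewrite running_mean_le// ltW.
Qed.

Lemma integrable_hardy_integrand : mu.-integrable `[(0:R), 1[ (EFin \o g).
Proof.
apply: (@integrable_bounded_itv _ _ _ _ (A 0 `^ (- v))).
  apply/measurable_fun_itv_obnd_cbndP.
  apply: nonincreasing_in_measurable => x y; rewrite !in_itv/=.
  move=> /andP[x0 x1] /andP[y0 y1] xy; rewrite /g.
  have x0w := ltW x0; have y0w := ltW y0.
  have x1w := ltW x1; have y1w := ltW y1.
  rewrite !fine_mean_running// nincr_powRN ?(ltW v_gt0) ?running_mean_le//.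
  exact: running_mean_gt0.
move=> x; rewrite in_itv/= => /andP[x0 x1].
by rewrite powR_ge0 hardy_integrand_le.
Qed.

(** For t < 1 the value phi t bounds phi on [0,t), hence all its means there. *)
Lemma hardy_le_lt1 t : 0 <= t -> t < 1 ->
  hardy_K p q (M `^ u) * G t <=
  u * (p - 1) * (M `^ u - p `^ (- (u + 1))) * (t * A t `^ (- v)).
Proof.
move=> t0 t1.
have c0 : 0 <= M `^ u by exact: powR_ge0.
have vp : v * (p - 1) = 1 by rewrite mulVf// gt_eqF// subr_gt0.
have KE : hardy_K p q (M `^ u) = p `^ (- u) - M `^ u * (1 - u * (p - 1)).
  have q0 : q - 1 != 0 by rewrite subr_eq0 gt_eqF.
  by rewrite /hardy_K -powRN /u; field.
have K0' := ltW K0; rewrite KE in K0' *.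
have E := @hardy_bounded _ p u v (M `^ u)
  (ltW p1) (ltW dual_exponent_gt0) uv vp c0 A H G t (phi t) t0 K0'.
have G0 : G 0 = 0 by rewrite /G set_itv_ge ?Rintegral_set0// bnd_simp ltxx.
rewrite -[G t]subr0 -G0; apply: E.
- by move=> s /andP[s0 st]; rewrite running_mean_gt0// (le_trans st)// ltW.
- by move=> s s' s0 ss' s't; rewrite running_mean_le// (le_trans s't)// ltW.
- by rewrite /H set_itv_ge ?Rintegral_set0// bnd_simp ltxx.
- by move=> s /andP[s0 st]; rewrite weight_dual_le// s0 (le_trans st)// ltW.
move=> s s' s0 ss' s't m.
have s'1 : s' < 1 by exact: le_lt_trans t1.
have d0 : 0 < s' - s by rewrite subr_gt0.
have ss'w := ltW ss'; have s'1w := ltW s'1.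
have s'0 := le_trans s0 ss'w.
have mE : m = (\int[mu]_(x in `[s, s'[) phi x) / (s' - s).
  rewrite /m -!primitiveE (primitive_split s0 ss'w s'1w).
  by congr (_ / _); ring.
have in01 x : x \in `[s, s'[ -> x \in `[(0:R), 1[.
  rewrite !in_itv/= => /andP[sx xs'].
  by rewrite (le_trans s0 sx) (lt_trans xs').
split.
- rewrite mE ler_pdivrMr//; apply: le_trans (weight_incr_le s0 ss'w s'1) _.
  apply: ler_wpM2r; first exact: ltW.
  case: wphi => _ + _; apply => //; rewrite in_itv/= ?s'0//.
  by rewrite t0 t1.
- rewrite mE (dual_primitive_split s0 ss'w s'1w) [X in _ <= X]addrC addKr.
  apply: jensen_powRN => //; first exact: ltW dual_exponent_gt0.
  + by move=> x /in01; exact: weight_gt0.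
  + exact: integrable_weight_sub.
  + exact: integrable_dual_sub.
  + apply: lt_le_trans (weight_incr_ge s0 ss' s'1w).
    by rewrite mulr_gt0// weight_gt0// in_itv/= s0 (lt_trans ss').
- rewrite /G (@Rintegral_itv_split _ 0 s s')//; last first.
    by apply: integrable_sub_itv integrable_hardy_integrand.
  rewrite [X in X <= _]addrC addKr mulrC; apply: Rintegral_itv_le_cst => //.
    by apply: integrable_sub_itv integrable_hardy_integrand.
  move=> x; rewrite in_itv/= => /andP[sx xs'].
  by rewrite hardy_integrand_le// (lt_trans xs').
Qed.

(** At t = 1 there is no bound on phi near the endpoint, so the inequality is
    obtained as a limit from t < 1. *)
Lemma hardy_le t : 0 < t -> t <= 1 ->
  hardy_K p q (M `^ u) * G t <=
  u * (p - 1) * (M `^ u - p `^ (- (u + 1))) * (t * A t `^ (- v)).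
Proof.
move=> t0; rewrite le_eqVlt => /predU1P[->|t1]; last first.
  exact: hardy_le_lt1 (ltW t0) t1.
set C := u * (p - 1) * _; rewrite mul1r.
have A1 : 0 < A 1 by rewrite running_mean_gt0.
have cF : F s @[s --> 1^'-] --> F 1.
  exact: (Rintegral_itv_left_cvg ltr01 integrable_weight).
have cid : s @[s --> (1:R)^'-] --> (1:R).
  by apply: cvg_at_left_filter; exact: cvg_id.
have cA : F s / s @[s --> 1^'-] --> A 1.
  rewrite /A /running_mean oner_eq0; apply: cvgM => //.
  by apply: cvgV => //; exact: oner_neq0.
have cP : (F s / s) `^ (- v) @[s --> 1^'-] --> A 1 `^ (- v).
  have cont : {for A 1, continuous (fun x : R => x `^ (- v))}.
    apply/differentiable_continuous/derivable1_diffP.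
    by apply: derivable_powR; rewrite in_itv/= A1.
  exact: (continuous_cvg _ cont cA).
apply: (@ler_cvg_to _ ((1:R)^'-) _ _ (fun s => hardy_K p q (M `^ u) * G s)
   (fun s => C * (s * (F s / s) `^ (- v)))).
- apply: cvgM; first exact: cvg_cst.
  exact: (Rintegral_itv_left_cvg ltr01 integrable_hardy_integrand).
- apply: cvgM; first exact: cvg_cst.
  by rewrite -[X in _ --> X]mul1r; apply: cvgM.
near=> s.
have s0 : 0 < s by near: s; exact: nbhs_left_gt.
have s1 : s < 1 by near: s; exact: nbhs_left_lt.
have := hardy_le_lt1 (ltW s0) s1.
by rewrite /A /running_mean gt_eqF.
Unshelve. all: by end_near. Qed.

Lemma hardy_inequality t : 0 < t -> t <= 1 ->
  (hardy_lhs p phi t <= (hardy_rhs p q M phi t)%:E)%E.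
Proof.
move=> t0 t1; rewrite /hardy_lhs meanE; last first.
  by apply: integrable_sub_itv integrable_hardy_integrand.
rewrite lee_fin -/v -/(G t) /hardy_rhs fine_mean_running// -/u -/v.
rewrite ler_pdivrMr//.
have := hardy_constant_le p1 pq (powR_ge0 M u) K0; rewrite -/u.
move=> /(ler_wpM2r (mulr_ge0 (ltW t0) (powR_ge0 (A t) (- v)))).
have := hardy_le t0 t1; rewrite -ler_pdivlMl// => hG hC.
apply: (le_trans hG); move: hC; rewrite !mulrA => /le_trans; apply.
by apply: eq_ler; rewrite -/u; ring.
Qed.

End exponent.

End weight.

(** * Sharpness *)

Section power.
Context (R : realType).
Notation mu := (@lebesgue_measure R).
Implicit Types (a b r : R).

Lemma continuous_within_powR a b r : 0 < a ->
  {within `[a, b], continuous (fun x => x `^ r)}.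
Proof.
move=> a0; apply: derivable_within_continuous => x.
rewrite in_itv/= => /andP[ax _].
by apply: derivable_powR; rewrite in_itv/= andbT (lt_le_trans a0).
Qed.

Lemma integrable_powR a b r : 0 < a ->
  mu.-integrable `[a, b[ (EFin \o (fun x => x `^ r)).
Proof.
move=> a0; have : mu.-integrable `[a, b] (EFin \o (fun x => x `^ r)).
  apply: continuous_compact_integrable; first exact: segment_compact.
  exact: continuous_within_powR.
by apply: integrableS => //; apply: subset_itvl; rewrite bnd_simp.
Qed.

Lemma Rintegral_powR a b r : 0 < a -> a <= b -> r + 1 != 0 ->
  \int[mu]_(x in `[a, b[) x `^ r = (b `^ (r + 1) - a `^ (r + 1)) / (r + 1).
Proof.
move=> a0; rewrite le_eqVlt => /predU1P[<- _|ab r1].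
  by rewrite subrr mul0r set_itv_ge ?Rintegral_set0// bnd_simp ltxx.
rewrite Rintegral_itv_bndo_bndc; last exact: integrable_powR.
have D (x : R) : 0 < x ->
    is_derive x (1:R) (fun x => x `^ (r + 1) / (r + 1)) (x `^ r).
  move=> x0; have Dx := is_derive1_powR (r + 1) x0.
  have -> : (fun x : R => x `^ (r + 1) / (r + 1)) =
      (r + 1)^-1 *: (fun x => x `^ (r + 1)).
    by apply/funext => y /=; rewrite mulrC.
  apply: is_derive_eq; rewrite addrK /GRing.scale/= mulrA mulVf// mul1r//.
rewrite /Rintegral.
rewrite (@continuous_FTC2 _ _ (fun x => x `^ (r + 1) / (r + 1)) _ _ ab).
- by rewrite -EFinB/= -mulrBl.
- exact: continuous_within_powR.
- have cw : {within `[a, b], continuous (fun x => x `^ (r + 1) / (r + 1))}.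
    apply: derivable_within_continuous => x; rewrite in_itv/= => /andP[ax _].
    by apply: ex_derive; apply: D; exact: lt_le_trans ax.
  have /(continuous_within_itvP _ ab)[_ ca cb] := cw.
  split=> // x; rewrite in_itv/= => /andP[ax _].
  by apply: ex_derive; apply: D; exact: lt_trans ax.
- move=> x; rewrite in_itv/= => /andP[ax _].
  by rewrite derive1E; have [_ ->] := D x (lt_trans a0 ax).
Qed.

End power.

(** The reciprocal is Bernoulli's inequality for x^(-1/(q-1)). At x = p0 it
    says that averaging the power weight near 0 does not increase the dual
    integral. *)
Lemma powR_le_ratio (R : realType) (q x : R) : 1 < q -> 0 < x -> x < q ->
  x `^ (q - 1)^-1 <= (q - 1) / (q - x).
Proof.
move=> q1 x0 xq.
have q0 : 0 < q - 1 by rewrite subr_gt0.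
have qx : 0 < q - x by rewrite subr_gt0.
rewrite -[X in _ <= X]invf_div -[X in X <= _]invrK.
rewrite lef_pV2 ?posrE ?invr_gt0 ?powR_gt0 ?divr_gt0// -powRN.
have u0 : 0 <= (q - 1)^-1 by rewrite invr_ge0 ltW.
apply: le_trans (bernoulli_powRN u0 x0).
by apply: eq_ler; field; rewrite gt_eqF.
Qed.

Section extremal.
Context (R : realType).
Variables (q M p0 e : R).
Hypotheses (M1 : 1 <= M) (crit : critical_exponent q M p0).
Hypotheses (e0 : 0 < e) (e1 : e < 1).
Notation mu := (@lebesgue_measure R).
Let u := (q - 1)^-1.
Let k := e `^ (p0 - 1) / p0.

(** The constant on [0,e) is the mean of x^(p0-1) over [0,e). *)
Definition extremal_weight (x : R) : R :=
  if x < e then e `^ (p0 - 1) / p0 else x `^ (p0 - 1).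

Let p01 : 1 < p0. Proof. by case: crit => /andP[]. Qed.
Let p0q : p0 < q. Proof. by case: crit => /andP[]. Qed.
Let p00 : 0 < p0. Proof. exact: lt_trans p01. Qed.
Let q1 : 0 < q - 1. Proof. by rewrite subr_gt0 (lt_trans p01). Qed.
Let u0 : 0 < u. Proof. by rewrite invr_gt0. Qed.
Let k0 : 0 < k. Proof. by rewrite divr_gt0// powR_gt0. Qed.
Let qu : (q - 1) * u = 1. Proof. by rewrite mulfV// gt_eqF. Qed.

Lemma piecewise_integral (f : R -> R) (l r t : R) :
  (forall x, x < e -> f x = l) -> (forall x, e <= x -> f x = x `^ r) ->
  r + 1 != 0 -> e <= t -> mu.-integrable `[0, t[ (EFin \o f) ->
  \int[mu]_(x in `[0, t[) f x = l * e + (t `^ (r + 1) - e `^ (r + 1)) / (r + 1).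
Proof.
move=> fl fr r1 et i.
rewrite (Rintegral_itv_split (ltW e0) et i); congr (_ + _).
  rewrite -[e in RHS]subr0 -Rintegral_itv_cst ?(ltW e0)//.
  by apply: eq_Rintegral => x; rewrite inE/= in_itv/= => /andP[_ /fl].
rewrite -Rintegral_powR//.
by apply: eq_Rintegral => x; rewrite inE/= in_itv/= => /andP[/fr].
Qed.

Let phi := extremal_weight.

Lemma extremal_weightl x : x < e -> phi x = k.
Proof. by rewrite /phi /extremal_weight => ->. Qed.

Lemma extremal_weightr x : e <= x -> phi x = x `^ (p0 - 1).
Proof. by rewrite /phi /extremal_weight ltNge => ->. Qed.

Lemma extremal_gt0 x : 0 < phi x.
Proof.
have [xe|ex] := ltP x e; first by rewrite extremal_weightl.
by rewrite extremal_weightr// powR_gt0// (lt_le_trans e0).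
Qed.

Lemma extremal_nondecr : {homo phi : x y / x <= y}.
Proof.
move=> x y xy; have p10 : 0 <= p0 - 1 by rewrite subr_ge0 ltW.
have mono a b : e <= a -> a <= b -> a `^ (p0 - 1) <= b `^ (p0 - 1).
  move=> ea ab; rewrite ge0_ler_powR// nnegrE (le_trans (ltW e0))//.
  exact: le_trans ea ab.
have [xe|ex] := ltP x e.
  rewrite (extremal_weightl xe); have [ye|ey] := ltP y e.
    by rewrite extremal_weightl.
  rewrite extremal_weightr//; apply: le_trans (mono _ _ (lexx e) ey).
  by rewrite ler_pdivrMr// ler_peMr ?powR_ge0// ltW.
by rewrite !extremal_weightr// ?mono// (le_trans ex).
Qed.

Lemma extremal_integrable t : t <= 1 -> mu.-integrable `[0, t[ (EFin \o phi).
Proof.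
move=> t1; apply: (@integrable_bounded_itv _ _ _ _ (phi 1)).
  by apply: nondecreasing_in_measurable => x y _ _; exact: extremal_nondecr.
move=> x; rewrite in_itv/= => /andP[_ xt]; rewrite ltW ?extremal_gt0//=.
by rewrite extremal_nondecr// ltW// (lt_le_trans xt).
Qed.

Lemma extremal_dual_integrable t :
  mu.-integrable `[0, t[ (EFin \o (fun x => phi x `^ (- u))).
Proof.
apply: (@integrable_bounded_itv _ _ _ _ (phi 0 `^ (- u))).
  apply: nonincreasing_in_measurable => x y _ _ xy.
  by rewrite nincr_powRN ?(ltW u0) ?extremal_gt0// extremal_nondecr.
move=> x; rewrite in_itv/= => /andP[x0 _].
by rewrite powR_ge0 nincr_powRN ?(ltW u0) ?extremal_gt0// extremal_nondecr.
Qed.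

Lemma extremal_mean t : e <= t -> t <= 1 ->
  mean phi t = (t `^ (p0 - 1) / p0)%:E.
Proof.
move=> et t1; rewrite meanE ?extremal_integrable//; congr EFin.
have t0 := lt_le_trans e0 et.
rewrite (piecewise_integral extremal_weightl extremal_weightr)//; last 2 first.
- by rewrite subrK gt_eqF.
- exact: extremal_integrable.
have E x : 0 < x -> x `^ p0 = x * x `^ (p0 - 1).
  by move=> x0; rewrite mulr_powRB1// ltW.
rewrite subrK !E// /k; field.
by rewrite !gt_eqF.
Qed.

(** The right-hand side is the dual mean of the power weight itself. *)
Lemma extremal_dual_le t : e <= t ->
  (\int[mu]_(x in `[0, t[) phi x `^ (- u)) / t <=
  t `^ (- ((p0 - 1) * u)) * ((q - 1) / (q - p0)).
Proof.
move=> et; have t0 := lt_le_trans e0 et.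
have bE : 1 - (p0 - 1) * u = (q - p0) / (q - 1).
  by rewrite /u; field; rewrite gt_eqF.
have b0 : 0 < (q - p0) / (q - 1) by rewrite divr_gt0// subr_gt0.
have dl x : x < e -> phi x `^ (- u) = k `^ (- u).
  by move=> xe; rewrite extremal_weightl.
have dr x : e <= x -> phi x `^ (- u) = x `^ (- ((p0 - 1) * u)).
  by move=> xe; rewrite extremal_weightr// -powRrM mulrN.
rewrite (piecewise_integral dl dr)//; last 2 first.
- by rewrite addrC bE gt_eqF.
- exact: extremal_dual_integrable.
have p0u : p0 `^ u <= (q - 1) / (q - p0).
  by apply: powR_le_ratio => //; rewrite -subr_gt0.
have kE : k `^ (- u) * e = p0 `^ u * e `^ (- ((p0 - 1) * u) + 1).
  rewrite /k powRM ?powR_ge0 ?invr_ge0 ?(ltW p00)// -powR_inv1 ?(ltW p00)//.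
  by rewrite -!powRrM mulN1r opprK powRD_gt0// powRr1 ?(ltW e0)// mulrN; ring.
rewrite kE ler_pdivrMr// -(addrC 1) bE.
have -> : t `^ (- ((p0 - 1) * u)) * ((q - 1) / (q - p0)) * t =
    t `^ ((q - p0) / (q - 1)) * ((q - 1) / (q - p0)).
  by rewrite -bE powRD_gt0// powRr1 ?(ltW t0)//; ring.
have := ler_wpM2r (powR_ge0 e ((q - p0) / (q - 1))) p0u.
by rewrite invf_div; set W := (q - 1) / (q - p0); lra.
Qed.

Lemma extremal_muckenhoupt : muckenhoupt_weight q M phi.
Proof.
split; first by move=> x _; exact: extremal_gt0.
  by move=> x y _ _; exact: extremal_nondecr.
move=> t /andP[t0 t1].
have [te|et] := ltP t e.
  (* On [0,t) the weight is constant, and the product of the means is 1. *)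
  have cE (f : R -> R) l : (forall x, x < e -> f x = l) ->
      \int[mu]_(x in `[0, t[) f x / t = l.
    move=> fl; transitivity ((\int[mu]_(x in `[0, t[) cst l x) / t).
      congr (_ / _); apply: eq_Rintegral => x.
      by rewrite inE/= in_itv/= => /andP[_ xt]; rewrite fl// (lt_trans xt).
    by rewrite Rintegral_itv_cst ?(ltW t0)// subr0 mulfK// gt_eqF.
  rewrite !meanE ?extremal_integrable//; last exact: extremal_dual_integrable.
  rewrite (cE phi k)//; last exact: extremal_weightl.
  rewrite (cE _ (k `^ (- u))); last by move=> x xe; rewrite extremal_weightl.
  rewrite poweR_EFin lee_fin -powRrM mulNr (mulrC u) qu powR_inv1 ?(ltW k0)//.
  by rewrite mulfV// gt_eqF.
rewrite extremal_mean// meanE; last exact: extremal_dual_integrable.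
rewrite poweR_EFin lee_fin.
have D0 : 0 <= (\int[mu]_(x in `[0, t[) phi x `^ (- u)) / t.
  by rewrite divr_ge0 ?(ltW t0)// Rintegral_ge0// => x _; exact: powR_ge0.
apply: (@le_trans _ _ (t `^ (p0 - 1) / p0 *
  (t `^ (- ((p0 - 1) * u)) * ((q - 1) / (q - p0))) `^ (q - 1))).
  apply: ler_wpM2l; first by rewrite divr_ge0 ?powR_ge0 ?(ltW p00).
  apply: ge0_ler_powR (extremal_dual_le et); rewrite ?nnegrE ?(ltW q1)//.
  by rewrite mulr_ge0 ?powR_ge0// divr_ge0 ?(ltW q1)// subr_ge0 ltW.
have E : (q - 1) / (q - p0) = (M * p0) `^ u.
  have b0 : (q - p0) / (q - 1) != 0.
    by rewrite gt_eqF// divr_gt0// subr_gt0.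
  by case: crit => _ /(canRL (mulKf b0)) ->; rewrite mulr1 invf_div.
have M0 := le_trans ler01 M1.
rewrite E powRM ?powR_ge0// -!powRrM (mulrC u) qu powRr1 ?mulr_ge0 ?(ltW p00)//.
have -> : - ((p0 - 1) * u) * (q - 1) = - (p0 - 1).
  by rewrite mulNr -mulrA (mulrC u) qu mulr1.
rewrite powRN; apply: eq_ler; field.
by rewrite !gt_eqF ?powR_gt0.
Qed.

Lemma extremal_hardy_lhs p : p0 < p ->
  ((p0 `^ (p - 1)^-1 * ((p - 1) / (p - p0)
     * (1 - e `^ ((p - p0) / (p - 1)))))%:E <= hardy_lhs p phi 1)%E.
Proof.
move=> p0p; have p1 := lt_trans p01 p0p.
have pp1 : 0 < p - 1 by rewrite subr_gt0.
have ppp : 0 < p - p0 by rewrite subr_gt0.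
set v := (p - 1)^-1.
have q1' : 1 < q by exact: lt_trans p0q.
have gi := integrable_hardy_integrand q1' extremal_muckenhoupt p1.
rewrite /hardy_lhs meanE// lee_fin divr1.
rewrite (Rintegral_itv_split (ltW e0) (ltW e1) gi).
rewrite -[X in X <= _]add0r; apply: lerD.
  by apply: Rintegral_ge0 => x _; exact: powR_ge0.
have -> : \int[mu]_(x in `[e, 1[) fine (mean phi x) `^ (- v) =
    \int[mu]_(x in `[e, 1[) (p0 `^ v * x `^ (- ((p0 - 1) * v))).
  apply: eq_Rintegral => x; rewrite inE/= in_itv/= => /andP[ex x1].
  rewrite extremal_mean ?(ltW x1)//= powRM ?powR_ge0 ?invr_ge0 ?(ltW p00)//.
  by rewrite -powR_inv1 ?(ltW p00)// -!powRrM mulN1r opprK mulrN mulrC.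
have aE : - ((p0 - 1) * v) + 1 = (p - p0) / (p - 1).
  by rewrite /v; field; rewrite gt_eqF.
rewrite RintegralZl//; last exact: integrable_powR.
rewrite Rintegral_powR ?(ltW e1)// aE ?gt_eqF ?divr_gt0// powR1 invf_div.
by rewrite mulrC [X in _ <= _ * X]mulrC mulrC.
Qed.

End extremal.

(** By [hardy_K_ge] the right-hand side, divided by the left-hand side for the
    untruncated power weight, is at most (p-1)/(p0-1). With [rho] < 1 the
    quotient of theta by (p0-1)/(p-1), this leaves room for a relative loss
    [delta] < 1 - [rho], and truncating at e loses e^((p-p0)/(p-1)). *)
Lemma sharp_power (R : realType) (q M p0 p theta : R) :
  1 <= M -> critical_exponent q M p0 -> p0 < p ->
  theta * (p - 1) < p0 - 1 ->
  exists2 phi, muckenhoupt_weight q M phi &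
    ((theta * hardy_rhs p q M phi 1)%:E < hardy_lhs p phi 1)%E.
Proof.
move=> M1 crit p0p tp.
have [p01 p0q] : 1 < p0 /\ p0 < q by case: crit => /andP[].
have p1 := lt_trans p01 p0p.
have p00 : 0 < p0 by exact: lt_trans p01.
have pp : 0 < p by exact: lt_trans p0p.
have pp1 : 0 < p - 1 by rewrite subr_gt0.
have p01' : 0 < p0 - 1 by rewrite subr_gt0.
have ppp : 0 < p - p0 by rewrite subr_gt0.
have q0 : 0 < q by exact: lt_trans p0q.
have q1 : 0 < q - 1 by rewrite subr_gt0 (lt_trans p01).
pose rho := theta * (p - 1) / (p0 - 1).
have rho1 : rho < 1 by rewrite ltr_pdivrMr// mul1r.
pose delta := Num.min (2^-1) ((1 - rho) / 2).
have d0 : 0 < delta by rewrite lt_min; apply/andP; split; lra.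
have d1 : delta < 1 by rewrite gt_min; apply/orP; left; lra.
have rd : rho < 1 - delta.
  have : delta <= (1 - rho) / 2 by rewrite ge_min lexx orbT.
  lra.
pose a := (p - p0) / (p - 1).
have a0 : 0 < a by rewrite divr_gt0.
pose e := delta `^ a^-1.
have ea : e `^ a = delta.
  by rewrite -powRrM mulVf ?gt_eqF// powRr1// ltW.
have e0 : 0 < e by exact: powR_gt0.
have e1 : e < 1.
  have -> : 1 = 1 `^ a^-1 :> R by rewrite powR1.
  by apply: gt0_ltr_powR; rewrite ?invr_gt0 ?nnegrE// ltW.
exists (extremal_weight p0 e); first exact: extremal_muckenhoupt.
apply: lt_le_trans (extremal_hardy_lhs M1 crit e0 e1 p0p); rewrite lte_fin.
rewrite -/a ea /hardy_rhs (extremal_mean crit e0 (ltW e1) (lexx 1)).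
rewrite powR1/= div1r.
rewrite -powR_inv1 ?(ltW p00)// -powRrM mulN1r opprK.
set V := p0 `^ _; have V0 : 0 < V by exact: powR_gt0.
rewrite mulrCA ltr_pM2l//.
set c := M `^ _; set N := _ * _ ^+ 2.
have c0 : 0 < c by rewrite powR_gt0// (lt_le_trans _ M1).
have Kge := hardy_K_ge p01 p0q p0p (critical_constant M1 crit).
rewrite -/c in Kge.
set L := c * _ in Kge.
have L0 : 0 < L.
  by apply: mulr_gt0 => //; apply: divr_gt0; rewrite !mulr_gt0.
have K0 := lt_le_trans L0 Kge.
have N0 : 0 <= N.
  by rewrite !mulr_ge0 ?invr_ge0 ?(ltW K0) ?(ltW c0) ?(ltW q0) ?(ltW pp)
        ?(ltW pp1) ?(ltW q1).
have NL : N <= p0 / p * (p - 1) ^+ 2 / ((p0 - 1) * (p - p0)).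
  apply: (@le_trans _ _ (L^-1 * c * (q / p) * ((p - 1) / (q - 1)) ^+ 2)).
    rewrite /N -!mulrA; apply: ler_wpM2r.
      by rewrite !mulr_ge0 ?invr_ge0 ?(ltW c0) ?(ltW q0) ?(ltW pp)
        ?(ltW pp1) ?(ltW q1).
    by rewrite lef_pV2.
  apply: eq_ler; rewrite /L; field.
  by rewrite !gt_eqF.
have [t0|t0] := leP theta 0.
  apply: (@le_lt_trans _ _ 0); first by rewrite mulr_le0_ge0.
  by rewrite mulr_gt0 ?divr_gt0// subr_gt0.
apply: le_lt_trans (ler_wpM2l (ltW t0) NL) _.
have -> : theta * (p0 / p * (p - 1) ^+ 2 / ((p0 - 1) * (p - p0))) =
   (p - 1) / (p - p0) * (rho * (p0 / p)).
  by rewrite /rho; field; rewrite !gt_eqF.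
rewrite ltr_pM2l ?divr_gt0//; apply: le_lt_trans rd.
have rho0 : 0 <= rho by rewrite ltW// divr_gt0// mulr_gt0.
by rewrite ler_piMr// ler_pdivrMr// mul1r ltW.
Qed.

Lemma critical_exponent_exists (R : realType) (q p0 : R) : 1 < p0 -> p0 < q ->
  exists2 M, 1 <= M & critical_exponent q M p0.
Proof.
move=> p01 p0q.
have p00 : 0 < p0 by exact: lt_trans p01.
have q1 : 0 < q - 1 by rewrite subr_gt0 (lt_trans p01).
have qp : 0 < q - p0 by rewrite subr_gt0.
pose u := (q - 1)^-1.
have u0 : 0 < u by rewrite invr_gt0.
have W0 : 0 < (q - 1) / (q - p0) by rewrite divr_gt0.
exists (((q - 1) / (q - p0)) `^ (q - 1) / p0).
  rewrite ler_pdivlMr// mul1r.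
  rewrite [X in X <= _](_ : p0 = (p0 `^ u) `^ (q - 1)); last first.
    by rewrite -powRrM mulVf ?gt_eqF// powRr1// ltW.
  have q1' : 1 < q by exact: lt_trans p0q.
  apply: ge0_ler_powR (powR_le_ratio q1' p00 p0q); rewrite ?nnegrE ?powR_ge0//.
    exact: ltW.
  exact: ltW.
split; first by rewrite p01.
rewrite divfK ?gt_eqF// -powRrM mulfV ?gt_eqF// powRr1 ?(ltW W0)//.
by field; rewrite !gt_eqF.
Qed.

Unset Implicit Arguments.

Theorem theorem3 (R : realType) (q M p0 : R) (hq : 1 < q) (hM : 1 <= M)
    (hp0 : critical_exponent q M p0) :
  [/\ forall phi : R -> R, muckenhoupt_weight q M phi ->
        forall p : R, p0 < p <= q ->
        forall t : R, 0 < t <= 1 ->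
          (hardy_lhs p phi t <= (hardy_rhs p q M phi t)%:E)%E,
      sharp_in_p q M p0
    & sharp_in_M q].
Proof.
have [p01 p0q] : 1 < p0 /\ p0 < q by case: hp0 => /andP[].
split.
- move=> phi wphi p /andP[p0p pq] t /andP[t0 t1].
  have p1 := lt_trans p01 p0p.
  apply: hardy_inequality => //.
  apply: lt_le_trans (hardy_K_ge p01 p0q p0p (critical_constant hM hp0)).
  have p00 : 0 < p0 by exact: lt_trans p01.
  have q0 : 0 < q by exact: lt_trans p0q.
  apply: mulr_gt0; first by rewrite powR_gt0 ?(lt_le_trans _ hM).
  by apply: divr_gt0; rewrite !mulr_gt0 ?subr_gt0.
- move=> theta theta1.
  have p1 : 0 < p0 - 1 by rewrite subr_gt0.
  have [th0|th0] := leP theta 0.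
    near=> p; have p0p : p0 < p by near: p; exact: nbhs_right_gt.
    apply: (sharp_power hM hp0 p0p); apply: le_lt_trans p1.
    by rewrite mulr_le0_ge0// subr_ge0 ltW// (lt_trans p01).
  near=> p; have p0p : p0 < p by near: p; exact: nbhs_right_gt.
  apply: (sharp_power hM hp0 p0p); rewrite mulrC -ltr_pdivlMr// ltrBlDr.
  near: p; apply: nbhs_right_lt.
  by rewrite -ltrBlDr ltr_pdivlMr// -[X in _ < X]mulr1 ltr_pM2l.
- move=> p /andP[p1 pq] theta theta1.
  pose th := Num.max 2^-1 ((1 + theta) / 2).
  have th0 : 0 < th by rewrite lt_max; apply/orP; left; lra.
  have th1 : th < 1 by rewrite gt_max; apply/andP; split; lra.
  have tht : theta < th by rewrite lt_max; apply/orP; right; lra.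
  have pp1 : 0 < p - 1 by rewrite subr_gt0.
  pose r := 1 + th * (p - 1).
  have r1 : 1 < r by rewrite ltrDl mulr_gt0.
  have rp : r < p.
    by rewrite /r -ltrBrDl -[X in _ < X]mul1r ltr_pM2r.
  have [N N1 crit] := critical_exponent_exists r1 (lt_le_trans rp pq).
  have [|phi wphi lhs] := @sharp_power _ q N r p theta N1 crit rp.
    by rewrite /r [X in _ < X]addrC addKr ltr_pM2r.
  by exists N, r, phi.
Unshelve. all: by end_near. Qed.
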